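(* (1) There is an algorithm that, given a caterpillar binary GS-tree $T$ over a set $C$ of $m$ candidates (representing the domain $\mathrm{GS/cat}=\mathrm{GS}(T)$) and a ranking $v\in\mathcal{L}(C)$, computes $\mathrm{swap}(\mathrm{GS}(T),v)$ in time $O(m\log m)$. (2) There is an algorithm that, given a balanced binary GS-tree $T$ over a set $C$ of $m$ candidates (representing the domain $\mathrm{GS/bal}=\mathrm{GS}(T)$) and a ranking $v\in\mathcal{L}(C)$, computes $\mathrm{swap}(\mathrm{GS}(T),v)$ in time $O(m\log m)$.
   Context: $\mathcal{L}(C)$ is the set of all linear orders (rankings, votes) over $C$. The swap distance $\mathrm{swap}(u,v)$ is the number of unordered pairs of candidates whose relative order differs in $u$ and $v$. For a set of rankings $D$, $\mathrm{swap}(D,v)=\min_{u\in D}\mathrm{swap}(u,v)$. A GS-tree over $C$ is an ordered rooted tree in which each internal node has at least two children and whose leaves are labeled bijectively with the candidates in $C$. The frontier of such a tree is the ranking obtained by reading its leaves from left to right. $\mathrm{GS}(T)\subseteq\mathcal{L}(C)$ is the set of all rankings that are the frontier of $T$ or of a tree obtained from $T$ by reversing the order of the children of some of its nodes. A caterpillar binary tree is one in which each internal node has exactly two children, at least one of which is a leaf. A balanced binary tree is one in which each internal node has exactly two children and for each two leaves their distances from the root differ by at most $1$. *)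

(* Defs.v *)
From HB Require Import structures.
From mathcomp Require Import all_boot.
From Stdlib Require List.

Set Implicit Arguments.
Unset Strict Implicit.
Unset Printing Implicit Defensive.

(** ** Rankings and swap distance *)

(* A linear order over C, listed from the most to the least preferred
   candidate. *)
Record ranking (C : finType) := Ranking {
  rseq :> seq C;
  rankingP : perm_eq rseq (enum C)
}.

Definition prefers (C : finType) (r : ranking C) (a b : C) : bool :=
  index a r < index b r.

Definition swap (C : finType) (u v : ranking C) : nat :=
  #|[set [set p.1; p.2] | p : C * C & prefers u p.1 p.2 && prefers v p.2 p.1]|.

Definition is_swap_dist (C : finType) (D : ranking C -> Prop) (v : ranking C)
    (d : nat) : Prop :=
  (exists2 u, D u & swap u v = d) /\ (forall u, D u -> d <= swap u v).

(** ** GS-trees *)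

Inductive otree (C : Type) : Type :=
  | Leaf of C
  | Node of seq (otree C).
Arguments Leaf {C}.
Arguments Node {C}.

Definition is_leaf (C : Type) (t : otree C) : bool :=
  if t is Leaf _ then true else false.

Fixpoint frontier (C : Type) (t : otree C) : seq C :=
  match t with
  | Leaf c => [:: c]
  | Node ts => flatten (map (@frontier C) ts)
  end.

Fixpoint all_nodes (C : Type) (P : seq (otree C) -> bool) (t : otree C) : bool :=
  match t with
  | Leaf _ => true
  | Node ts => P ts && all (all_nodes P) ts
  end.

Definition gs_tree (C : finType) (t : otree C) : bool :=
  all_nodes (fun ts => 2 <= size ts) t && perm_eq (frontier t) (enum C).

Inductive reversal (C : Type) : otree C -> otree C -> Prop :=
  | reversal_leaf c : reversal (Leaf c) (Leaf c)
  | reversal_keep ts ts' :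
      List.Forall2 (@reversal C) ts ts' -> reversal (Node ts) (Node ts')
  | reversal_flip ts ts' :
      List.Forall2 (@reversal C) ts ts' -> reversal (Node ts) (Node (rev ts')).

Definition GS (C : finType) (t : otree C) (u : ranking C) : Prop :=
  exists2 t', reversal t t' & frontier t' = u.

Definition caterpillar (C : Type) (t : otree C) : bool :=
  all_nodes (fun ts => (size ts == 2) && has (@is_leaf C) ts) t.

Fixpoint leaf_depths (C : Type) (t : otree C) : seq nat :=
  match t with
  | Leaf _ => [:: 0]
  | Node ts => map succn (flatten (map (@leaf_depths C) ts))
  end.

Definition balanced (C : Type) (t : otree C) : bool :=
  all_nodes (fun ts => size ts == 2) t &&
  all2rel (fun d e => d <= e.+1) (leaf_depths t).

(** ** Random access machine *)

(* Programs over numbered registers and an addressable memory, both holding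
   natural numbers. A program mentions finitely many registers; arithmetic is
   limited to addition and truncated subtraction, so that unit cost per
   instruction is the uniform cost criterion. *)
Inductive test := TLt of nat & nat | TEq of nat & nat.

Inductive prog :=
  | Const of nat & nat
  | Add of nat & nat & nat
  | Sub of nat & nat & nat
  | Read of nat & nat
  | Write of nat & nat
  | Skip
  | Seq of prog & prog
  | If of test & prog & prog
  | While of test & prog.

Record state := State { reg : nat -> nat; cell : nat -> nat }.

Definition set_reg (s : state) (x n : nat) : state :=
  State [eta reg s with x |-> n] (cell s).

Definition set_cell (s : state) (a n : nat) : state :=
  State (reg s) [eta cell s with a |-> n].

Definition holds (b : test) (s : state) : bool :=
  match b with
  | TLt x y => reg s x < reg s y
  | TEq x y => reg s x == reg s y
  end.

(* [exec p s k s']: started in state s, the program p halts in state s' after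
   k elementary steps (instructions and evaluations of tests). *)
Inductive exec : prog -> state -> nat -> state -> Prop :=
  | exec_const x n s : exec (Const x n) s 1 (set_reg s x n)
  | exec_add x y z s : exec (Add x y z) s 1 (set_reg s x (reg s y + reg s z))
  | exec_sub x y z s : exec (Sub x y z) s 1 (set_reg s x (reg s y - reg s z))
  | exec_read x y s : exec (Read x y) s 1 (set_reg s x (cell s (reg s y)))
  | exec_write x y s : exec (Write x y) s 1 (set_cell s (reg s x) (reg s y))
  | exec_skip s : exec Skip s 1 s
  | exec_seq p q s1 s2 s3 k l :
      exec p s1 k s2 -> exec q s2 l s3 -> exec (Seq p q) s1 (k + l) s3
  | exec_if b p q s s' k :
      exec (if holds b s then p else q) s k s' -> exec (If b p q) s k.+1 s'
  | exec_while_false b p s : ~~ holds b s -> exec (While b p) s 1 s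
  | exec_while_true b p s1 s2 s3 k l :
      holds b s1 -> exec p s1 k s2 -> exec (While b p) s2 l s3 ->
      exec (While b p) s1 (k + l).+1 s3.

(* There is at most one run from a given state, so the existence of a run in
   [swap_computable_in] below determines time and output. *)
Lemma exec_deterministic p s k1 s1 k2 s2 :
  exec p s k1 s1 -> exec p s k2 s2 -> k1 = k2 /\ s1 = s2.
Proof.
move=> e1; elim: e1 k2 s2 => {p s k1 s1}; last first.
- move=> b p s1 s2 s3 k l bT _ IHp _ IHw k' s' e.
  inversion e as [| | | | | | | |b0 p0 s0 bF|b0 p0 t1 t2 t3 k0 l0 _ ep ew]; subst.
    by rewrite bT in bF.
  by have [-> ?] := IHp _ _ ep; subst; have [-> ->] := IHw _ _ ew.
- move=> b p s bF k' s' e.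
  inversion e as [| | | | | | | | |b0 p0 t1 t2 t3 k0 l0 bT]; subst=> //.
  by rewrite bT in bF.
- move=> b p q s s' k _ IH k' s'' e.
  inversion e as [| | | | | | |b0 p0 q0 t t' k0 ep| |]; subst.
  by have [-> ->] := IH _ _ ep.
- move=> p q s1 s2 s3 k l _ IHp _ IHq k' s' e.
  inversion e as [| | | | | |p0 q0 t1 t2 t3 k0 l0 ep eq| | |]; subst.
  by have [-> ?] := IHp _ _ ep; subst; have [-> ->] := IHq _ _ eq.
all: by move=> *; match goal with e : exec _ _ _ _ |- _ => inversion e end.
Qed.

Definition init_state (input : seq nat) : state := State (fun=> 0) (nth 0 input).

(** ** Input encoding and running time *)

(* Preorder listing of the tree: a leaf is the number 0 followed by its label,
   an internal node is its number of children followed by the children. *)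
Fixpoint encode_tree (C : Type) (num : C -> nat) (t : otree C) : seq nat :=
  match t with
  | Leaf c => [:: 0; num c]
  | Node ts => size ts :: flatten (map (encode_tree num) ts)
  end.

Definition encode_input (C : finType) (num : C -> nat) (t : otree C)
    (v : ranking C) : seq nat :=
  #|C| :: encode_tree num t ++ map num v.

Definition bigO (f g : nat -> nat) : Prop :=
  exists c n0, forall n, n0 <= n -> f n <= c * g n.

(* One program handles all candidate sets, all trees of the given class and all
   rankings. The candidates are presented as the numbers 0, ..., m - 1, in
   whatever order [num]; the answer is read off register 0. *)
Definition swap_computable_in (class : forall C : finType, otree C -> bool)
    (bound : nat -> nat) : Prop :=
  exists (p : prog) (time : nat -> nat),
    bigO time bound /\
    forall (C : finType) (num : C -> 'I_#|C|) (T : otree C) (v : ranking C),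
      injective num -> gs_tree T -> class C T ->
      exists k s,
        [/\ exec p (init_state (encode_input num T v)) k s,
            k <= time #|C| &
            is_swap_dist (GS T) v (reg s 0)].

(* Main.v *)
Require Import Defs.
From mathcomp Require Import all_boot.
From mathcomp Require Import zify.
From Stdlib Require List.

Set Implicit Arguments.
Unset Strict Implicit.
Unset Printing Implicit Defensive.

(** For a binary tree, the decisions to flip the nodes are independent: a node
    with children l and r contributes the smaller of the number of pairs in l x r
    that v inverts and the number of those that it does not invert.

    Caterpillar: at a node with a leaf x, only the number of candidates of the
    other child placed before x by v is needed. Going down from the root, it is
    the position of x minus the number of already removed candidates placed
    before x, which a heap of counters over the positions provides in time
    O(log m).

    Balanced: the candidates are handled in the order of v. For each of them, the
    program walks from the root of the tree down to its leaf. At each child on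
    the way it adds the number of earlier candidates below the sibling to a
    counter of inversions. The depth is O(log m), so this takes time
    O(m log m). *)

(** * Inversions in binary trees *)

Inductive btree (A : Type) := BLeaf of A | BNode of btree A & btree A.

Fixpoint front A (t : btree A) : seq A :=
  match t with BLeaf x => [:: x] | BNode l r => front l ++ front r end.

Fixpoint bmap A B (f : A -> B) (t : btree A) : btree B :=
  match t with
  | BLeaf x => BLeaf (f x)
  | BNode l r => BNode (bmap f l) (bmap f r)
  end.

Fixpoint otree_of A (t : btree A) : otree A :=
  match t with
  | BLeaf x => Leaf x
  | BNode l r => Node [:: otree_of l; otree_of r]
  end.

Fixpoint enc (lab : nat -> nat) (t : btree nat) : seq nat :=
  match t with
  | BLeaf x => [:: 0; lab x]
  | BNode l r => 2 :: enc lab l ++ enc lab r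
  end.

(** Labels are positions in [v], so a pair is inverted when the larger label stands first; this is
    the cost of placing the block [s1] before the block [s2]. *)
Definition crossings (s1 s2 : seq nat) : nat :=
  \sum_(x <- s1) count (fun y => y < x) s2.

Fixpoint inversions (s : seq nat) : nat :=
  if s is x :: s' then count (fun y => y < x) s' + inversions s' else 0.

Fixpoint dist (t : btree nat) : nat :=
  match t with
  | BLeaf _ => 0
  | BNode l r => dist l + dist r
      + minn (crossings (front l) (front r)) (crossings (front r) (front l))
  end.

Lemma inversions_cat s1 s2 :
  inversions (s1 ++ s2) = inversions s1 + inversions s2 + crossings s1 s2.
Proof.
elim: s1 => [|x s IH] /=; first by rewrite /crossings big_nil addn0.
by rewrite IH /crossings big_cons count_cat; lia.
Qed.

Lemma crossings_perm s1 s1' s2 s2' :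
  perm_eq s1 s1' -> perm_eq s2 s2' -> crossings s1 s2 = crossings s1' s2'.
Proof.
move=> p1 /permP p2; rewrite /crossings (perm_big _ p1).
by apply: eq_bigr => x _; apply: p2.
Qed.

Lemma front_bmap A B (f : A -> B) t : front (bmap f t) = map f (front t).
Proof. by elim: t => //= l -> r ->; rewrite map_cat. Qed.

Lemma frontier_otree_of A (t : btree A) : frontier (otree_of t) = front t.
Proof. by elim: t => //= l -> r ->; rewrite cats0. Qed.

Lemma reversal_leafI A (c : A) t : reversal (Leaf c) t -> t = Leaf c.
Proof. by move=> H; inversion H. Qed.

Lemma reversal_nodeI A (l r t : otree A) :
  reversal (Node [:: l; r]) t ->
  exists l' r', [/\ reversal l l', reversal r r' &
    t = Node [:: l'; r'] \/ t = Node [:: r'; l']].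
Proof.
move=> H; inversion H as [|ts ts' F|ts ts' F]; subst;
  inversion F as [|? l' ? ts1 Hl F1]; subst;
  inversion F1 as [|? r' ? ts2 Hr F2]; subst;
  inversion F2; subst; exists l', r'; split => //; [by left | by right].
Qed.

(** Crossings depend only on which leaves the two blocks contain, so reversals inside the children
    do not change the cost of a node, which is one of the two terms of its minimum. *)
Lemma reversal_bounds (A : eqType) (f : A -> nat) (b : btree A) t' :
  reversal (otree_of b) t' ->
  perm_eq (frontier t') (front b) /\
  dist (bmap f b) <= inversions (map f (frontier t')).
Proof.
elim: b t' => [x|l IHl r IHr] t' /=; first by move=> h; rewrite (reversal_leafI h) /=.
case/reversal_nodeI => l' [r' [/IHl[pl dl] /IHr[pr dr] E]].
have pil := perm_map f pl; have pir := perm_map f pr.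
case: E => -> /=; rewrite cats0 map_cat inversions_cat !front_bmap.
  split; first exact: perm_cat.
  by rewrite (crossings_perm pil pir) leq_add ?geq_minl // leq_add.
split; first by rewrite perm_catC perm_cat.
by rewrite (crossings_perm pir pil) leq_add ?geq_minr // addnC leq_add.
Qed.

(** The cheaper order of the two blocks is taken at every node; by the same invariance these choices
    do not interfere. *)
Lemma reversal_attained (A : eqType) (f : A -> nat) (b : btree A) :
  exists2 t', reversal (otree_of b) t' &
    inversions (map f (frontier t')) = dist (bmap f b).
Proof.
elim: b => [x|l [l' rl el] r [r' rr er]] /=.
  by exists (Leaf x); first exact: reversal_leaf.
have pil := perm_map f (reversal_bounds f rl).1.
have pir := perm_map f (reversal_bounds f rr).1.
have F : List.Forall2 (@reversal A) [:: otree_of l; otree_of r] [:: l'; r'].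
  by do 2?constructor.
rewrite !front_bmap -(crossings_perm pil pir) -(crossings_perm pir pil).
case: (leqP (crossings (map f (frontier l')) (map f (frontier r')))
            (crossings (map f (frontier r')) (map f (frontier l')))) => h.
  exists (Node [:: l'; r']); first exact: reversal_keep.
  by rewrite /= cats0 map_cat inversions_cat el er.
exists (Node [:: r'; l']); first exact: (reversal_flip F).
by rewrite /= cats0 map_cat inversions_cat el er (addnC (dist _)).
Qed.

(** * Swap distance as a number of inversions *)

Lemma rankingS (C : finType) (v : ranking C) :
  [/\ uniq v, rseq v =i predT & size v = #|C|].
Proof.
have p := rankingP v; split; first by rewrite (perm_uniq p) enum_uniq.
  by move=> x; rewrite (perm_mem p) mem_enum.
by rewrite (perm_size p) cardE.
Qed.

Lemma inversionsE (A : eqType) (f : A -> nat) (s : seq A) : uniq s ->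
  inversions (map f s) =
  \sum_(a <- s) \sum_(b <- s) ((index a s < index b s) && (f b < f a)).
Proof.
elim: s => [|x s IH] /=; first by rewrite big_nil.
case/andP=> xs us; rewrite big_cons IH //; congr (_ + _).
  rewrite big_cons eqxx ltnn /= add0n count_map -sum1_count big_mkcond.
  rewrite big_seq [RHS]big_seq; apply: eq_bigr => b bs.
  have /negPf -> : x != b by apply: contraNneq xs => ->.
  by rewrite /=; case: (_ < _).
rewrite big_seq [RHS]big_seq; apply: eq_bigr => a sa.
have /negPf na : x != a by apply: contraNneq xs => ->.
rewrite big_cons eqxx na ltn0 /= add0n.
rewrite big_seq [RHS]big_seq; apply: eq_bigr => b sb.
have /negPf nb : x != b by apply: contraNneq xs => ->.
by rewrite nb ltnS.
Qed.

(** An unordered pair counted by [swap] comes from only one ordered pair, the one ordered as in [u],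
    so counting sets and counting ordered pairs agree. *)
Lemma swapE (C : finType) (u v : ranking C) :
  swap u v = inversions (map (index^~ v) u).
Proof.
have [uu mu _] := rankingS u; have [_ mv _] := rankingS v.
rewrite inversionsE //.
have pe : perm_eq u (index_enum C).
  by apply: uniq_perm; rewrite ?index_enum_uniq // => x; rewrite mu mem_index_enum.
rewrite (perm_big _ pe); under eq_bigr do rewrite (perm_big _ pe).
rewrite pair_big /= /swap card_in_imset.
  by rewrite -sum1dep_card big_mkcond; apply: eq_bigr => p _;
    rewrite /prefers; case: ifP.
move=> [a b] [c d]; rewrite !inE /= => /andP[ab ba] /andP[cd dc] E.
have na : a != b by apply: contraTneq ab => ->; rewrite /prefers ltnn.
have: a \in [set c; d] by rewrite -E !inE eqxx.
have: b \in [set c; d] by rewrite -E !inE eqxx orbT.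
rewrite !inE => /orP[]/eqP eb /orP[]/eqP ea; subst; rewrite ?eqxx // in na *.
by move: ab cd; rewrite /prefers; lia.
Qed.

Lemma all_nodes_binary (A : Type) (P : seq (otree A) -> bool) (T : otree A) :
  (forall ts, P ts -> size ts == 2) -> all_nodes P T ->
  exists b, T = otree_of b.
Proof.
(* [otree] is nested in [seq], so the recursion on the two children is written as a raw fixpoint. *)
move=> P2; move: T; fix IH 1; case=> [c _|ts /= /andP[/P2]].
  by exists (BLeaf c).
case: ts => [|l [|r [|]]] //= _ /and3P[/IH[bl ->] /IH[br ->] _].
by exists (BNode bl br).
Qed.

Lemma encode_tree_otree_of (A : eqType) (num f : A -> nat) lab (b : btree A) :
  {in front b, forall c, lab (f c) = num c} ->
  encode_tree num (otree_of b) = enc lab (bmap f b).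
Proof.
elim: b => [x|l IHl r IHr] /= H; first by rewrite H ?inE.
by rewrite cats0 IHl 1?IHr // => c cin; apply: H; rewrite mem_cat cin ?orbT.
Qed.

(* The candidates may be renamed to their positions in v: [lab i] is the number
   of the i-th candidate of v. *)
Lemma swap_computableI (class : forall C : finType, otree C -> bool)
    (bclass : btree nat -> bool) p time bound :
  (forall C T, class C T -> exists b, T = otree_of b) ->
  (forall (C : finType) (b : btree C) (f : C -> nat),
     class C (otree_of b) -> bclass (bmap f b)) ->
  bigO time bound ->
  (forall m lab t, 0 < m -> bclass t -> perm_eq (front t) (iota 0 m) ->
     {in gtn m &, injective lab} -> (forall i, i < m -> lab i < m) ->
     exists k s, [/\ exec p (init_state (m :: enc lab t ++ map lab (iota 0 m))) k s,
       k <= time m & reg s 0 = dist t]) ->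
  swap_computable_in class bound.
Proof.
move=> bin cls bO H; exists p, time; split=> // C num T v inj_num gsT clT.
have [b eT] := bin _ _ clT; subst T.
have [uv mv sv] := rankingS v.
pose f := index^~ (rseq v).
have f_lt c : f c < size v by rewrite index_mem mv.
pose lab i := nth 0 (map (fun c => nat_of_ord (num c)) v) i.
have labE c : lab (f c) = num c.
  by rewrite /lab (nth_map c) ?f_lt // /f nth_index ?mv.
have /andP[_] := gsT; rewrite frontier_otree_of => pf.
have f_iota : map f v = iota 0 #|C|.
  apply: (@eq_from_nth _ 0); rewrite ?size_map ?size_iota // => i ilt.
  have x0 : C by case: (rseq v) ilt.
  by rewrite (nth_map x0) // nth_iota -?sv // /f index_uniq.
have pt : perm_eq (front (bmap f b)) (iota 0 #|C|).
  rewrite front_bmap -f_iota; apply: perm_map.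
  by rewrite (perm_trans pf) // perm_sym rankingP.
have ex_i i : i < #|C| -> exists c, i = f c.
  move=> ilt; have : i \in map f v by rewrite f_iota mem_iota.
  by case/mapP => c _ e; exists c.
have C0 : 0 < #|C|.
  rewrite -(size_iota 0 #|C|) -(perm_size pt) front_bmap size_map.
  by elim: (b) => //= l IH r _; rewrite size_cat; lia.
have [|i ilt|k [s [ex kt rs]]] := H #|C| lab (bmap f b) C0 (cls _ _ f clT) pt.
- move=> i j /= /ex_i[c ->] /ex_i[d ->]; rewrite !labE => /val_inj /inj_num.
  by move=> ->.
- by have [c ->] := ex_i _ ilt; rewrite labE.
exists k, s; split => //.
  rewrite /encode_input (@encode_tree_otree_of C num f lab) //.
  suff -> : map (fun c => nat_of_ord (num c)) v = map lab (iota 0 #|C|) by [].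
  by rewrite -f_iota -map_comp; apply: eq_map => c /=; rewrite labE.
rewrite rs; split.
  have [t' rt' et'] := reversal_attained f b.
  have [p1 _] := reversal_bounds f rt'.
  (* The frontier of the optimal reversal permutes the candidates, which makes it a ranking. *)
  by exists (Ranking (perm_trans p1 pf)); [exists t' | rewrite swapE].
move=> u [t' rt' eu]; have [_] := reversal_bounds f rt'.
by rewrite swapE eu.
Qed.

(** * Running programs *)

Notation "p ;; q" := (Seq p q) (at level 60, right associativity).

Definition upd (M : nat -> nat) (a n : nat) : nat -> nat :=
  fun b => if b == a then n else M b.

(* The register file is a sequence, so that programs with concrete registers
   can be executed symbolically. *)
Definition matches (l : seq nat) (M : nat -> nat) (s : state) : Prop :=
  reg s =1 nth 0 l /\ cell s =1 M.

(** A total-correctness triple with a time budget. The postcondition speaks of register contents and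
    memory, so it can itself be a [runs] claim about the rest of the program. *)
Definition runs (p : prog) (l : seq nat) (M : nat -> nat) (t : nat)
    (Q : seq nat -> (nat -> nat) -> Prop) : Prop :=
  forall s, matches l M s ->
  exists k s' l' M', [/\ exec p s k s', k <= t, matches l' M' s' & Q l' M'].

Definition atomic (p : prog) : bool :=
  match p with Seq _ _ | If _ _ _ | While _ _ => false | _ => true end.

Definition regs_after (p : prog) (l : seq nat) (M : nat -> nat) : seq nat :=
  match p with
  | Const x n => set_nth 0 l x n
  | Add x y z => set_nth 0 l x (nth 0 l y + nth 0 l z)
  | Defs.Sub x y z => set_nth 0 l x (nth 0 l y - nth 0 l z)
  | Read x y => set_nth 0 l x (M (nth 0 l y))
  | _ => l
  end.

Definition mem_after (p : prog) (l : seq nat) (M : nat -> nat) : nat -> nat :=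
  if p is Write x y then upd M (nth 0 l x) (nth 0 l y) else M.

Definition test_on (b : test) (l : seq nat) : bool :=
  match b with
  | TLt x y => nth 0 l x < nth 0 l y
  | TEq x y => nth 0 l x == nth 0 l y
  end.

Lemma exec_atomic p l M s : atomic p -> matches l M s ->
  exists2 s', exec p s 1 s' & matches (regs_after p l M) (mem_after p l M) s'.
Proof.
have upd_reg s0 x n : matches l M s0 -> matches (set_nth 0 l x n) M (set_reg s0 x n).
  by case=> r c; split=> // i; rewrite /= nth_set_nth /= r.
case: p => // [x n|x y z|x y z|x y|x y|] _ ms; have [r c] := ms.
- by exists (set_reg s x n); [constructor | exact: upd_reg].
- by eexists; [constructor | rewrite !r; exact: upd_reg].
- by eexists; [constructor | rewrite !r; exact: upd_reg].
- by eexists; [constructor | rewrite r c; exact: upd_reg].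
- exists (set_cell s (reg s x) (reg s y)); first by constructor.
  by split=> [|a] /=; [exact: r | rewrite /upd !r c].
- by exists s; [constructor |].
Qed.

Lemma holdsE b l M s : matches l M s -> holds b s = test_on b l.
Proof. by case=> r _; case: b => x y /=; rewrite !r. Qed.

Lemma runs_last p l M t Q : atomic p -> 0 < t ->
  Q (regs_after p l M) (mem_after p l M) -> runs p l M t Q.
Proof.
move=> ap t0 HQ s ms; have [s' ex ms'] := exec_atomic ap ms.
by exists 1, s', (regs_after p l M), (mem_after p l M).
Qed.

Lemma runs_step p q l M t Q : atomic p -> 0 < t ->
  runs q (regs_after p l M) (mem_after p l M) t.-1 Q -> runs (Seq p q) l M t Q.
Proof.
move=> ap t0 H s ms; have [s' ex ms'] := exec_atomic ap ms.
have [k [s2 [l2 [M2 [ex2 kt m2 HQ]]]]] := H _ ms'.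
exists (1 + k), s2, l2, M2; split=> //; first exact: exec_seq ex ex2.
by case: t t0 kt {H}.
Qed.

Lemma runs_seq p q l M t1 t2 Q :
  runs p l M t1 (fun l' M' => runs q l' M' t2 Q) -> runs (Seq p q) l M (t1 + t2) Q.
Proof.
move=> H s /H[k1 [s1 [l1 [M1 [e1 k1t m1 /(_ _ m1)]]]]].
move=> [k2 [s2 [l2 [M2 [e2 k2t m2 HQ]]]]].
by exists (k1 + k2), s2, l2, M2; split=> //; [exact: exec_seq e1 e2 | exact: leq_add].
Qed.

Lemma runs_le t p l M t' Q : runs p l M t Q -> t <= t' -> runs p l M t' Q.
Proof.
move=> H tt s /H[k [s' [l' [M' [ex kt m HQ]]]]].
by exists k, s', l', M'; split=> //; exact: leq_trans kt tt.
Qed.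

Lemma runs_if b p q l M t Q : 0 < t ->
  (test_on b l -> runs p l M t.-1 Q) -> (~~ test_on b l -> runs q l M t.-1 Q) ->
  runs (If b p q) l M t Q.
Proof.
move=> t0 Hp Hq s ms.
have : runs (if test_on b l then p else q) l M t.-1 Q.
  by case: ifP => [|/negbT]; [exact: Hp | exact: Hq].
move=> /(_ s ms)[k [s' [l' [M' [ex kt m HQ]]]]].
exists k.+1, s', l', M'; split=> //; last by case: t t0 kt {Hp Hq}.
by apply: exec_if; rewrite (holdsE _ ms).
Qed.

(** Flattening to the right exposes the next instruction; the time is unchanged because addition is
    associative. *)
Lemma runs_seqA p q r l M t Q :
  runs (Seq p (Seq q r)) l M t Q -> runs (Seq (Seq p q) r) l M t Q.
Proof.
move=> H s /H[k [s' [l' [M' [ex kt m HQ]]]]]; exists k, s', l', M'; split=> //.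
inversion ex as [| | | | | |? ? ? s2 ? k1 k2 e1 e2| | |]; subst.
inversion e2 as [| | | | | |? ? ? s3 ? k3 k4 e3 e4| | |]; subst.
by rewrite addnA; apply: exec_seq e4; apply: exec_seq e3.
Qed.

(** The continuation [r] is copied into both branches, so each is executed to its end with its own
    registers and no common postcondition has to be found. *)
Lemma runs_if_seq b p q r l M t Q : 0 < t ->
  (test_on b l -> runs (Seq p r) l M t.-1 Q) ->
  (~~ test_on b l -> runs (Seq q r) l M t.-1 Q) ->
  runs (Seq (If b p q) r) l M t Q.
Proof.
move=> t0 Hp Hq s ms.
have : runs (Seq (if test_on b l then p else q) r) l M t.-1 Q.
  by case: ifP => [|/negbT]; [exact: Hp | exact: Hq].
move=> /(_ s ms)[k [s' [l' [M' [ex kt m HQ]]]]].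
exists k.+1, s', l', M'; split=> //; last by case: t t0 kt {Hp Hq}.
inversion ex as [| | | | | |? ? ? s2 ? k1 k2 e1 e2| | |]; subst.
rewrite -addSn; apply: exec_seq e2; apply: exec_if.
by rewrite (holdsE _ ms).
Qed.

Lemma runs_while_false b p l M t Q : ~~ test_on b l -> 0 < t ->
  Q l M -> runs (While b p) l M t Q.
Proof.
move=> bF t0 HQ s ms; exists 1, s, l, M; split=> //.
by apply: exec_while_false; rewrite (holdsE _ ms).
Qed.

Lemma runs_while_true b p l M t1 t2 Q : test_on b l ->
  runs p l M t1 (fun l' M' => runs (While b p) l' M' t2 Q) ->
  runs (While b p) l M (t1 + t2).+1 Q.
Proof.
move=> bT H s ms; have [k1 [s1 [l1 [M1 [e1 k1t m1]]]]] := H s ms.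
move=> /(_ _ m1)[k2 [s2 [l2 [M2 [e2 k2t m2 HQ]]]]].
exists (k1 + k2).+1, s2, l2, M2; split=> //; last by rewrite ltnS leq_add.
by apply: exec_while_true e1 e2; rewrite (holdsE _ ms).
Qed.

Lemma runs_exec p input regs t (P : nat -> Prop) :
  runs p (nseq regs 0) (nth 0 input) t (fun l _ => P (nth 0 l 0)) ->
  exists k s, [/\ exec p (init_state input) k s, k <= t & P (reg s 0)].
Proof.
move=> /(_ (init_state input)) [|k [s [l [M [ex kt [r _] HP]]]]].
  by split=> // i; rewrite /= nth_nseq if_same.
by exists k, s; rewrite r.
Qed.

Ltac step :=
  repeat apply: runs_seqA;
  first [ apply: runs_step; [by [] | by rewrite ?addnS | rewrite /= ]
        | apply: runs_last; [by [] | by rewrite ?addnS | rewrite /= ] ].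

(** * Memory contents and layout of the input *)

Definition stores (M : nat -> nat) (a : nat) (s : seq nat) : Prop :=
  map M (iota a (size s)) = s.

Lemma stores_cons M a x s : stores M a (x :: s) <-> M a = x /\ stores M a.+1 s.
Proof. by rewrite /stores /=; split=> [[-> ->]|[-> ->]]. Qed.

Lemma stores_cat M a s1 s2 :
  stores M a (s1 ++ s2) <-> stores M a s1 /\ stores M (a + size s1) s2.
Proof.
rewrite /stores size_cat iotaD map_cat; split=> [/eqP|[-> ->] //].
by rewrite eqseq_cat ?size_map ?size_iota // => /andP[/eqP-> /eqP->].
Qed.

Lemma stores_eq M M' a s : {in [pred z | a <= z < a + size s], M' =1 M} ->
  stores M a s -> stores M' a s.
Proof.
move=> E <-; rewrite /stores size_map size_iota; apply/eq_in_map => z.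
by rewrite mem_iota => zin; apply: E.
Qed.

Lemma updE M a n : upd M a n a = n.
Proof. by rewrite /upd eqxx. Qed.

Lemma updNE M a n b : b != a -> upd M a n b = M b.
Proof. by rewrite /upd => /negPf ->. Qed.

(** A binary tree with n leaves has n - 1 internal nodes; a leaf takes two cells and an internal
    node one. *)
Lemma size_enc lab t : size (enc lab t) = 3 * size (front t) - 1 /\ 0 < size (front t).
Proof.
elim: t => //= l [el l0] r [er r0].
by rewrite !size_cat el er; lia.
Qed.

Lemma initial_memory lab t m (M := nth 0 (m :: enc lab t ++ map lab (iota 0 m))) :
  size (front t) = m ->
  [/\ M 0 = m, stores M 1 (enc lab t), stores M (3 * m) (map lab (iota 0 m)) &
      forall z, 4 * m <= z -> M z = 0].
Proof.
move=> sm; have [se m0] := size_enc lab t; rewrite sm in se m0.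
have sM : stores M 0 (m :: enc lab t ++ map lab (iota 0 m)).
  apply: (@eq_from_nth _ 0); rewrite size_map size_iota // => i i_lt.
  by rewrite (nth_map 0) ?size_iota // nth_iota.
have [M0 /stores_cat[s1 s2]] := (stores_cons _ _ _ _).1 sM.
split=> //.
  by rewrite (_ : 3 * m = 1 + size (enc lab t)) //; lia.
(* Past the input, the default value 0 of [nth] is read; the counters rely on this
   initialization. *)
move=> z zm; apply: nth_default.
by rewrite /= size_cat size_map size_iota; lia.
Qed.

(* Registers 1 and 16 hold 1 and 0, and registers 2 to 5 hold m, 3 * m, 4 * m and
   5 * m, where m is the number of candidates: the tree is at address 1, the
   ranking at 3 * m, the array indexed by candidates at 4 * m, and the counters
   start at 5 * m. *)
Definition setup : prog :=
  Const 1 1 ;; Read 2 16 ;; Add 3 2 2 ;; Add 3 3 2 ;; Add 4 3 2 ;; Add 5 4 2.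

(** For m at least 2 the logarithm is at least 1, so adding 1 at most doubles it: hence the constant
    200. *)
Lemma bigO_log :
  bigO (fun m => 100 * (m * (trunc_log 2 m + 1))) (fun m => m * trunc_log 2 m).
Proof.
exists 200, 2 => m m2; have : 0 < trunc_log 2 m by rewrite trunc_log_gt0.
by nia.
Qed.

(** * Caterpillars *)

(** Register 12 goes down from the root 1 to the leaf 2 ^ k + x, the children of node A being 2A and
    2A + 1. Without shifts, the bits of x are read from the top: doubling register 11 and comparing
    it with 2 ^ k yields the next bit. On a bit 1, the candidates counted at the left sibling
    precede x and are subtracted from register 10. *)
Definition cat_descent : prog :=
  While (TLt 12 6) (
    Add 11 11 11 ;; Add 12 12 12 ;;
    If (TLt 11 6) Skip
      (Defs.Sub 11 11 6 ;; Add 13 5 12 ;; Read 13 13 ;; Defs.Sub 10 10 13 ;;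
       Add 12 12 1) ;;
    Add 13 5 12 ;; Read 14 13 ;; Add 14 14 1 ;; Write 13 14).

(* The heap of counters at address K: node A counts the z in S whose leaf
   2 ^ k + z is below A. While x is being added, the nodes of height at
   least i have already counted it. *)
Definition heap (K k x i : nat) (S : seq nat) (M : nat -> nat) : Prop :=
  forall A, 2 <= A < 2 * 2 ^ k ->
    M (K + A) = count (fun z => (2 ^ k + z) %/ 2 ^ (k - trunc_log 2 A) == A)
                  (if i <= k - trunc_log 2 A then x :: S else S).

(** [A] is the only node of height [i] on the path to the leaf of [x], so one increment settles this
    height. *)
Lemma heap_step K k x i S M (A := (2 ^ k + x) %/ 2 ^ i) :
  k - trunc_log 2 A = i -> heap K k x i.+1 S M ->
  heap K k x i S (upd M (K + A) (M (K + A) + 1)).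
Proof.
move=> iA hM B Bk; rewrite /upd eqn_add2l.
case: (B =P A) => [eB|/eqP nB].
  by rewrite eB hM -?eB // eB iA ltnn leqnn /= -/A eqxx addn1.
rewrite (hM _ Bk) [in RHS]leq_eqVlt.
case: (i =P _) => [<-|_] //=.
by rewrite ltnn /= -/A eq_sym (negPf nB).
Qed.

(** Node [a] is the ancestor at height [i] of the leaf of [x], and [r] holds the [i] low bits still
    unread. The members of [S] under nodes to the left of [a] at this height have been subtracted
    from register 10; at height 0 these are the members below [x]. *)
Lemma cat_descent_runs k x S i ans m V P K lo hi n t u c M a r Q :
  x < 2 ^ k -> i <= k -> 2 ^ k + x = a * 2 ^ i + r -> r < 2 ^ i ->
  heap K k x i S M ->
  (forall M' y' a' t' u', heap K k x 0 S M' -> {in gtn K, M' =1 M} ->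
    Q [:: ans; 1; m; V; P; K; 2 ^ k; lo; hi; n;
          x - count (fun z => z < x) S; y'; a'; t'; u'; c; 0] M') ->
  runs cat_descent [:: ans; 1; m; V; P; K; 2 ^ k; lo; hi; n;
      x - count (fun z => (2 ^ k + z) %/ 2 ^ i < a) S;
      r * 2 ^ (k - i); a; t; u; c; 0] M (15 * i + 1) Q.
Proof.
move=> xk; elim: i => [|i IH] in M a r t u * => ik Ea ri hM HQ.
  have Er : r = 0 by rewrite expn0 in ri; lia.
  subst r; rewrite expn0 muln1 addn0 in Ea.
  apply: runs_while_false => //=; first by rewrite -leqNgt -Ea leq_addr.
  rewrite mul0n -Ea.
  rewrite (@eq_count _ _ (fun z => z < x)); last first.
    by move=> z; rewrite expn0 divn1 ltn_add2l.
  by apply: HQ.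
have ek : 2 ^ k = 2 ^ (k - i.+1) * (2 * 2 ^ i).
  by rewrite -expnS -expnD subnK.
have pi : 0 < 2 ^ i by rewrite expn_gt0.
have pk : 0 < 2 ^ (k - i.+1) by rewrite expn_gt0.
have eki : k - i = (k - i.+1).+1 by lia.
have aL : a < 2 ^ k by rewrite expnS in Ea; nia.
have a0 : 0 < a.
  case: a Ea {aL} => // Ea; rewrite mul0n add0n in Ea.
  by move: ri; rewrite -Ea expnS; nia.
have NE z : (2 ^ k + z) %/ 2 ^ i.+1 = (2 ^ k + z) %/ 2 ^ i %/ 2.
  by rewrite -divnMA -expnSr.
(* Both children of [a] have height [i], since 2 ^ (k - i) <= 2 * a + b < 2 ^ (k - i + 1). *)
have log_a b : b < 2 -> k - trunc_log 2 (2 * a + b) = i.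
  move=> b2; suff -> : trunc_log 2 (2 * a + b) = k - i by lia.
  apply: trunc_log_eq => //; rewrite eki !expnS.
  have Wa : 2 ^ (k - i.+1) < a.+1.
    rewrite -(ltn_pmul2r (m := 2 * 2 ^ i)) ?muln_gt0 // -ek.
    by rewrite expnS in Ea ri; lia.
  have aW : a < 2 * 2 ^ (k - i.+1).
    rewrite -(ltn_pmul2r (m := 2 * 2 ^ i)) ?muln_gt0 // -mulnA -ek.
    by rewrite expnS in Ea; lia.
  lia.
have Ea0 : a + a = 2 * a + 0 by lia.
have Ey : r * 2 ^ (k - i.+1) + r * 2 ^ (k - i.+1) = r * 2 ^ (k - i).
  by rewrite eki expnS; lia.
apply: (@runs_le (14 + (15 * i + 1)).+1); last lia.
apply: runs_while_true => //=.
do 2 step.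
apply: runs_if_seq => //= [lt_r|].
  have {}lt_r : r < 2 ^ i.
    move: lt_r; rewrite -mulnDl addnn -mul2n ek (mulnC (2 * r)).
    by rewrite ltn_pmul2l // ltn_pmul2l.
  have EA : 2 ^ k + x = (2 * a) * 2 ^ i + r by rewrite Ea expnS; lia.
  have HA : (2 ^ k + x) %/ 2 ^ i = 2 * a + 0.
    by rewrite EA divnMDl // divn_small // addn0.
  do 5 step.
  rewrite Ey Ea0 -HA.
  rewrite (_ : count _ S = count (fun z => (2 ^ k + z) %/ 2 ^ i < 2 * a) S); last first.
    by apply: eq_count => z /=; rewrite NE ltn_divLR // mulnC.
  rewrite HA addn0.
  apply: IH => //; [exact: ltnW | |].
    rewrite -(addn0 (2 * a)) -HA; apply: heap_step => //.
    by rewrite HA log_a.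
  move=> M' y' a' t' u' h' eM; apply: HQ => // z zK.
  by rewrite eM // updNE //; rewrite inE in zK; lia.
move=> /= ge_r.
have {}ge_r : 2 ^ i <= r.
  move: ge_r; rewrite -leqNgt -mulnDl addnn -mul2n ek (mulnC (2 * r)).
  by rewrite leq_pmul2l // leq_pmul2l.
have EA : 2 ^ k + x = (2 * a + 1) * 2 ^ i + (r - 2 ^ i).
  by rewrite Ea expnS; lia.
have rI : r - 2 ^ i < 2 ^ i by rewrite expnS in ri; lia.
have HA : (2 ^ k + x) %/ 2 ^ i = 2 * a + 1.
  by rewrite EA divnMDl // divn_small // addn0.
do 9 step.
have a2 : 2 <= 2 * a + 0 < 2 * 2 ^ k by lia.
rewrite (_ : a + a + 1 = 2 * a + 1); last lia.
rewrite Ea0 (hM _ a2) log_a // ltnn addn0.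
rewrite -subnDA.
(* To the left of 2 * a + 1 lie the children of the nodes to the left of [a], and the left sibling 2
   * a. *)
rewrite (_ : count _ S + count _ S =
             count (fun z => (2 ^ k + z) %/ 2 ^ i < 2 * a + 1) S); last first.
  rewrite (eq_count (a2 := fun z => (2 ^ k + z) %/ 2 ^ i < 2 * a)); last first.
    by move=> z /=; rewrite NE ltn_divLR // mulnC.
  rewrite -count_predUI [X in _ + X](eq_count (a2 := pred0)) ?count_pred0 ?addn0.
    by apply: eq_count => z /=; rewrite orbC addn1 ltnS -leq_eqVlt.
  by move=> z /=; lia.
rewrite (_ : r * _ + r * _ - 2 ^ k = (r - 2 ^ i) * 2 ^ (k - i)); last first.
  by rewrite Ey {1}ek eki expnS; nia.
apply: IH => //; first exact: ltnW.
  by rewrite -HA; apply: heap_step => //; rewrite HA log_a.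
move=> M' y' a' t' u' h' eM; apply: HQ => // z zK.
by rewrite eM // updNE //; rewrite inE in zK; lia.
Qed.

(** Register 15 holds the number of the leaf candidate and register 9 the number of candidates of
    the other child. The final read fetches the header of the remaining tree for the test of
    [cat_loop]. *)
Definition cat_count : prog :=
  Add 15 4 15 ;; Read 10 15 ;; Const 12 1 ;; Add 11 10 16 ;;
  cat_descent ;;
  Defs.Sub 14 9 10 ;; If (TLt 10 14) (Add 0 0 10) (Add 0 0 14) ;;
  Read 13 7.

(** The leaf child is found without parsing. The remaining tree occupies the cells from register 7
    up to, but excluding, register 8. If the cell after the header is 0, the left child is a leaf;
    otherwise the right child is, and its label is in the last cell. *)
Definition cat_loop : prog :=
  While (TLt 16 13) (
    Defs.Sub 9 9 1 ;; Add 7 7 1 ;; Read 13 7 ;;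
    If (TEq 13 16) (Add 7 7 1 ;; Read 15 7 ;; Add 7 7 1)
      (Defs.Sub 8 8 1 ;; Read 15 8 ;; Defs.Sub 8 8 1) ;;
    cat_count).

Definition heap_of (K k : nat) (S : seq nat) (M : nat -> nat) : Prop :=
  forall A, 2 <= A < 2 * 2 ^ k ->
    M (K + A) = count (fun z => (2 ^ k + z) %/ 2 ^ (k - trunc_log 2 A) == A) S.

(** Only the root has height [k], and no counter is kept for it, so at the start of a descent no
    node has to count [x] yet. *)
Lemma heap_of_top K k x S M : heap_of K k S M -> heap K k x k S M.
Proof.
move=> hM A A2; rewrite hM //.
have /andP[A2l Alt] := A2.
have l1 := trunc_log_max (isT : 1 < 2) (A2l : 2 ^ 1 <= A).
have k0 : 0 < k by case: (k) Alt => //; rewrite expn0; lia.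
by rewrite (_ : (k <= _) = false) //; lia.
Qed.

Lemma cat_count_runs k x S ans m V P K lo hi n x0 y a t u c M Q :
  x < 2 ^ k -> M (P + c) = x -> lo < K -> heap_of K k S M ->
  (forall M' y' a' u' c' (s := x - count (fun z => z < x) S),
    heap_of K k (x :: S) M' -> {in gtn K, M' =1 M} ->
    Q [:: ans + minn s (n - s); 1; m; V; P; K; 2 ^ k; lo; hi; n; s; y'; a';
          M' lo; u'; c'; 0] M') ->
  runs cat_count [:: ans; 1; m; V; P; K; 2 ^ k; lo; hi; n; x0; y; a; t; u; c; 0]
    M (15 * k + 10) Q.
Proof.
move=> xk Mc loK hM HQ; rewrite /cat_count.
do 4 step; rewrite Mc addn0.
apply: (@runs_le ((15 * k + 1) + 5)); last lia.
apply: runs_seq.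
(* No node lies to the left of the root, so the descent starts from [x] itself. *)
have e0 : x - count (fun z => (2 ^ k + z) %/ 2 ^ k < 1) S = x.
  rewrite (eq_count (a2 := pred0)) ?count_pred0 ?subn0 // => z /=.
  by rewrite ltn_divLR ?expn_gt0 // mul1n ltnNge leq_addr.
have D := @cat_descent_runs k x S k ans m V P K lo hi n t u (P + c) M 1 x.
rewrite e0 subnn muln1 mul1n in D; apply: D => //.
  exact: heap_of_top.
move=> M' y' a' t' u' hM' eM.
step; set s := x - _ in HQ *.
have eQ : M' lo = M' lo by [].
have hM'' : heap_of K k (x :: S) M' by move=> A /hM'.
apply: runs_if_seq => //= h; do 2 step.
  by have := HQ M' y' a' (n - s) (P + c) hM'' eM; rewrite /minn h.
by have := HQ M' y' a' (n - s) (P + c) hM'' eM; rewrite /minn (negPf h).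
Qed.

Fixpoint bcaterpillar (A : Type) (t : btree A) : bool :=
  match t with
  | BLeaf _ => true
  | BNode (BLeaf _) t' | BNode t' (BLeaf _) => bcaterpillar t'
  | _ => false
  end.

Lemma crossings1s x s : crossings [:: x] s = count (fun y => y < x) s.
Proof. by rewrite /crossings big_seq1. Qed.

Lemma crossings_s1 x s : x \notin s ->
  crossings s [:: x] = size s - count (fun y => y < x) s.
Proof.
move=> xs; rewrite /crossings -(count_predC (fun y => y < x) s) addKn -sum1_count.
rewrite [RHS]big_mkcond big_seq [RHS]big_seq; apply: eq_bigr => y ys /=.
have ne : x != y by apply: contraNneq xs => ->.
by rewrite addn0; case: ltngtP ne.
Qed.

(** Exactly [x] positions are below [x], and each of them is either already removed, in [S], or
    still present, in [s]. *)
Lemma count_remaining m S x s : perm_eq (S ++ x :: s) (iota 0 m) ->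
  [/\ x < m, x \notin s &
      x - count (fun z => z < x) S = count (fun z => z < x) s].
Proof.
move=> p.
have xm : x < m.
  have : x \in iota 0 m by rewrite -(perm_mem p) mem_cat inE eqxx orbT.
  by rewrite mem_iota.
split => //.
  have := iota_uniq 0 m; rewrite -(perm_uniq p) cat_uniq /=.
  by case/and4P.
have := permP p (fun z => z < x); rewrite count_cat /= ltnn add0n.
have -> : m = x + (m - x) by lia.
rewrite iotaD count_cat.
have -> : count (fun z => z < x) (iota 0 x) = x.
  rewrite -[RHS](size_iota 0 x); apply/eqP; rewrite -all_count.
  by apply/allP => z; rewrite mem_iota.
have -> : count (fun z => z < x) (iota (0 + x) (m - x)) = 0.
  rewrite (eq_in_count (a2 := pred0)) ?count_pred0 // => z.
  by rewrite mem_iota /=; lia.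
by move=> e; lia.
Qed.

(** The claim is named as a predicate of [t] so that it can be assumed for the remaining child in
    [cat_peel_runs], which serves leaves on either side. [S] lists the removed candidates. *)
Definition cat_loop_correct lab k m V P K Q t : Prop :=
  forall S ans lo hi n x y a u c M,
  stores M lo (enc lab t) -> hi = lo + size (enc lab t) -> hi < K ->
  (forall i, i < m -> P + lab i < K /\ M (P + lab i) = i) ->
  perm_eq (S ++ front t) (iota 0 m) -> heap_of K k S M -> n = size (front t) ->
  (forall l M', nth 0 l 0 = ans + dist t -> Q l M') ->
  runs cat_loop [:: ans; 1; m; V; P; K; 2 ^ k; lo; hi; n; x; y; a; M lo; u; c; 0] M
    ((15 * k + 30) * n + 1) Q.

Lemma cat_peel_runs lab k m V P K Q t z S ans lo hi n x y a u tt M :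
  cat_loop_correct lab k m V P K Q t -> m <= 2 ^ k ->
  stores M lo (enc lab t) -> hi = lo + size (enc lab t) -> hi < K ->
  (forall i, i < m -> P + lab i < K /\ M (P + lab i) = i) ->
  perm_eq (S ++ z :: front t) (iota 0 m) -> heap_of K k S M ->
  n = size (front t) ->
  (forall l M', nth 0 l 0 = ans + (dist t +
       minn (crossings [:: z] (front t)) (crossings (front t) [:: z])) -> Q l M') ->
  runs cat_count
    [:: ans; 1; m; V; P; K; 2 ^ k; lo; hi; n; x; y; a; tt; u; lab z; 0] M
    (15 * k + 10) (fun l M' => runs cat_loop l M' ((15 * k + 30) * n + 1) Q).
Proof.
move=> ok mk st hiE hiK pos p hM nE HQ.
have [zm zs xE] := count_remaining p.
apply: cat_count_runs (leq_trans zm mk) (pos _ zm).2 _ hM _ => [|M' y' a' u' c' s h' eM].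
  by lia.
apply: (ok (z :: S)) => //.
- by apply: stores_eq st => w; rewrite inE => w_in; apply: eM; rewrite inE; lia.
- by move=> i im; have [iK Mi] := pos i im; rewrite eM.
- by rewrite -(cat1s z) perm_catCA in p.
move=> l M1 e; apply: HQ.
by rewrite e crossings1s crossings_s1 // /s xE nE -addnA (addnC (minn _ _)).
Qed.

Lemma cat_loop_runs lab k m V P K Q t : m <= 2 ^ k -> bcaterpillar t ->
  cat_loop_correct lab k m V P K Q t.
Proof.
move=> mk.
elim: t => [z|l IHl r IHr] ct S ans lo hi n x y a u c M.
  move=> st _ _ _ _ _ _ HQ.
  have [M0 _] := (stores_cons M lo 0 [:: lab z]).1 st.
  apply: runs_while_false; rewrite /= ?M0 ?addn1 //.
  by apply: HQ; rewrite /= addn0.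
move=> st hiE hiK pos p hM nE HQ.
have [M0 st1] := (stores_cons _ _ _ _).1 st.
have n1 : 0 < n.-1.
  have [_ l0] := size_enc lab l; have [_ r0] := size_enc lab r.
  by rewrite nE /= size_cat; lia.
apply: (@runs_le ((10 + (15 * k + 10)) + ((15 * k + 30) * n.-1 + 1)).+1); last nia.
apply: runs_while_true; first by rewrite /= M0.
do 3 step.
case: l IHl ct st st1 hiE p nE HQ => [z|ll lr] IHl ct st st1 hiE p nE HQ.
  have [M1 /stores_cons[M2 st2]] := (stores_cons _ _ _ _).1 st1.
  apply: runs_if_seq => /=; first by rewrite ?addnS.
    move=> _; do 3 step.
    apply: runs_le (leq_addl _ _); rewrite subn1 (addn1 lo) (addn1 lo.+1) (addn1 lo.+2) M2.
    apply: (cat_peel_runs (t := r) (S := S)) => //; first exact: IHr.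
    - by rewrite hiE /=; lia.
    - by rewrite nE.
  by move=> /eqP []; rewrite addn1.
(* The left child is not a leaf, so the right one is, and its label is in the last cell before
   [hi]. *)
have ctl : bcaterpillar (BNode ll lr) by case: r ct {IHr st st1 hiE p nE HQ}.
have [z er] : exists z, r = BLeaf z.
  by case: r ct {IHr st st1 hiE p nE HQ} => // z; exists z.
subst r; have [stl str] := (stores_cat _ _ _ _).1 st1.
have [R0 /stores_cons[R1 _]] := (stores_cons _ _ _ _).1 str.
have [M1 _] := (stores_cons _ _ _ _).1 stl.
apply: runs_if_seq => /=; first by rewrite ?addnS.
  by move=> /eqP; rewrite addn1 M1.
move=> _; do 3 step.
apply: runs_le (leq_addl _ _); rewrite (addn1 lo) !subn1.
have -> : hi.-1 = (lo.+1 + size (enc lab (BNode ll lr))).+1.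
  by rewrite hiE /= !size_cat /=; lia.
rewrite R1.
apply: (cat_peel_runs (t := BNode ll lr) (S := S)) => //; first exact: IHl.
- by move: hiK; rewrite hiE /= !size_cat /=; lia.
- by apply: perm_trans p; rewrite perm_cat2l -cat1s perm_catC.
- by rewrite nE /= size_cat /= addn1.
move=> l M' e; apply: HQ; rewrite e.
by rewrite /= addn0 (minnC (crossings [:: z] _)).
Qed.

(** * Heap size, position table and the complete caterpillar program *)

Definition power_loop : prog := While (TLt 6 2) (Add 6 6 6).

(** This inverts the ranking: the cell indexed by a candidate number receives the position of that
    candidate in v. *)
Definition position_loop : prog :=
  While (TLt 9 2)
    (Add 13 3 9 ;; Read 15 13 ;; Add 15 4 15 ;; Write 15 9 ;; Add 9 9 1).

Definition cat_prog : prog :=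
  setup ;; Const 6 1 ;; power_loop ;; position_loop ;;
  Const 7 1 ;; Add 8 3 16 ;; Read 13 7 ;; cat_loop.

Lemma power_loop_runs ans m V P K r7 r8 r9 r10 r11 r12 r13 r14 r15 M Q j
    (k := up_log 2 m) : j <= k ->
  Q [:: ans; 1; m; V; P; K; 2 ^ k; r7; r8; r9; r10; r11; r12; r13; r14; r15; 0] M ->
  runs power_loop
    [:: ans; 1; m; V; P; K; 2 ^ j; r7; r8; r9; r10; r11; r12; r13; r14; r15; 0] M
    (2 * (k - j) + 1) Q.
Proof.
move: {2}(k - j) (erefl (k - j)) => d; elim: d j => [|d IH] j dE jk HQ.
  have -> : j = k by lia.
  apply: runs_while_false => //=; last by lia.
  by rewrite -leqNgt up_logP.
apply: (@runs_le (1 + (2 * (k - j.+1) + 1)).+1); last lia.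
apply: runs_while_true => /=.
  rewrite ltnNge; apply/negP => mj.
  by have := up_log_min (isT : 1 < 2) mj; rewrite -/k; lia.
step; rewrite addnn -mul2n -expnS.
by apply: IH => //; lia.
Qed.

Lemma position_loop_runs lab ans m K r6 r7 r8 i r10 r11 r12 r13 r14 r15 M Q :
  {in gtn m &, injective lab} -> (forall i, i < m -> lab i < m) -> i <= m ->
  stores M (3 * m) (map lab (iota 0 m)) ->
  (forall j, j < i -> M (4 * m + lab j) = j) ->
  (forall M' r13' r15',
    {in [pred z | (z < 4 * m) || (5 * m <= z)], M' =1 M} ->
    (forall j, j < m -> M' (4 * m + lab j) = j) ->
    Q [:: ans; 1; m; 3 * m; 4 * m; K; r6; r7; r8; m; r10; r11; r12; r13'; r14;
          r15'; 0] M') ->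
  runs position_loop
    [:: ans; 1; m; 3 * m; 4 * m; K; r6; r7; r8; i; r10; r11; r12; r13; r14;
        r15; 0] M (6 * (m - i) + 1) Q.
Proof.
move=> inj lt_m.
move: {2}(m - i) (erefl (m - i)) => d.
elim: d i r13 r15 M => [|d IH] i r13 r15 M dE im st Mi HQ.
  have e : i = m by lia.
  subst i; apply: runs_while_false => //=; [by rewrite ltnn | by lia |].
  exact: HQ.
have {}im : i < m by lia.
apply: (@runs_le (5 + (6 * (m - i.+1) + 1)).+1); last lia.
apply: runs_while_true => //=.
do 5 step.
have -> : M (3 * m + i) = lab i.
  have := congr1 (fun s => nth 0 s i) st.
  rewrite size_map size_iota !(nth_map 0) ?size_iota // !nth_iota //.
have li := lt_m _ im.
rewrite addn1; apply: IH => //; first lia.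
- apply: stores_eq st => z; rewrite inE size_map size_iota => zin.
  by rewrite updNE //; lia.
(* Labels are distinct, so writing position [i] spares the earlier entries. *)
- move=> j; rewrite ltnS leq_eqVlt => /predU1P[->|ji]; first exact: updE.
  rewrite updNE ?Mi // eqn_add2l; apply/eqP => /inj e.
  by have := e (ltn_trans ji im) im; lia.
move=> M' r13' r15' eM; apply: HQ => z zin; rewrite eM // updNE //.
by move: zin; rewrite inE; lia.
Qed.

Lemma up_log_le_trunc_log m : up_log 2 m <= trunc_log 2 m + 1.
Proof. by apply: up_log_min => //; rewrite addn1 ltnW // trunc_log_ltn. Qed.

(** The left side adds the budgets in program order: seven instructions, the power loop, the
    position loop, three instructions, the main loop. *)
Lemma cat_time m k T : 0 < m -> k <= T + 1 ->
  7 + (2 * (k - 0) + 1 + (6 * (m - 0) + 1 + (3 + ((15 * k + 30) * m + 1)))) <=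
  100 * (m * (T + 1)).
Proof.
move=> m0 kT; have : k * m <= (T + 1) * m by rewrite leq_mul2r kT orbT.
have : T + 1 <= m * (T + 1) by rewrite leq_pmull.
by rewrite mulnDl; nia.
Qed.

Lemma cat_prog_runs m lab t : 0 < m -> bcaterpillar t ->
  perm_eq (front t) (iota 0 m) ->
  {in gtn m &, injective lab} -> (forall i, i < m -> lab i < m) ->
  exists k s, [/\
    exec cat_prog (init_state (m :: enc lab t ++ map lab (iota 0 m))) k s,
    k <= 100 * (m * (trunc_log 2 m + 1)) & reg s 0 = dist t].
Proof.
move=> m0 ct pt inj lt_m.
have sm : size (front t) = m by rewrite (perm_size pt) size_iota.
have [se _] := size_enc lab t; rewrite sm in se.
apply: (runs_exec (regs := 17) (P := fun d => d = dist t)).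
have [M0 st sv z0] := initial_memory lab sm.
move: (nth 0 _) M0 st sv z0 => M M0 st sv z0.
set k := up_log 2 m.
have kT : k <= trunc_log 2 m + 1 by exact: up_log_le_trunc_log.
apply: (runs_le _ (cat_time m0 kT)).
rewrite /cat_prog /setup.
do 7 step.
rewrite M0.
have [-> -> ->] : [/\ m + m + m = 3 * m, 3 * m + m = 4 * m & 4 * m + m = 5 * m].
  by split; lia.
rewrite add0n.
(* Register 6 starts at 1, which is 2 ^ 0. *)
apply: runs_seq; apply: (@power_loop_runs _ _ _ _ _ _ _ _ _ _ _ _ _ _ _ _ 0) => //.
apply: runs_seq; apply: (@position_loop_runs lab) => // M' r13 r15 eM pM.
do 3 step.
rewrite add0n addn0.
apply: (@cat_loop_runs lab k m (3 * m) (4 * m) (5 * m) _ t _ ct [::]) => //.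
- exact: up_logP.
- apply: stores_eq st => z; rewrite inE => zin; apply: eM; rewrite inE; lia.
- lia.
- lia.
- by move=> i im; split; [have := lt_m i im; lia | exact: pM].
- by move=> A A2; rewrite eM ?inE ?leq_addr ?orbT // z0 //; lia.
Qed.

Lemma cat_computable :
  swap_computable_in (fun C : finType => @caterpillar C) (fun m => m * trunc_log 2 m).
Proof.
apply: (swap_computableI (bclass := @bcaterpillar nat)
         (time := fun m => 100 * (m * (trunc_log 2 m + 1)))).
- by move=> C T; apply: all_nodes_binary => ts /andP[].
- move=> C b f; elim: b => //= l IHl r IHr.
  rewrite /caterpillar /= !andbT => /and3P[lr /IHl cl /IHr cr].
  by case: l r lr cl cr {IHl IHr} => [x|l1 l2] [y|r1 r2].
- exact: bigO_log.
- exact: cat_prog_runs.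
Qed.

(** * Balanced trees *)

Fixpoint esize (t : btree nat) : nat :=
  match t with BLeaf _ => 2 | BNode l r => (esize l + esize r).+1 end.

Fixpoint height (A : Type) (t : btree A) : nat :=
  match t with BLeaf _ => 0 | BNode l r => (maxn (height l) (height r)).+1 end.

Fixpoint leaf_address (t : btree nat) (a x : nat) : nat :=
  match t with
  | BLeaf _ => a
  | BNode l r => if x \in front l then leaf_address l a.+1 x
                 else leaf_address r (a.+1 + esize l) x
  end.

(* After parsing, the cell of an internal node holds the address of its right
   child; its left child is in the next cell. *)
Fixpoint links (M : nat -> nat) (t : btree nat) (a : nat) : Prop :=
  match t with
  | BLeaf _ => M a = 0
  | BNode l r => [/\ M a = a.+1 + esize l, links M l a.+1 &
                    links M r (a.+1 + esize l)]
  end.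

Lemma size_encE lab t : size (enc lab t) = esize t.
Proof. by elim: t => //= l <- r <-; rewrite size_cat. Qed.

Lemma esize_gt0 t : 0 < esize t.
Proof. by case: t. Qed.

Lemma links_eq M M' t a : {in [pred z | a <= z < a + esize t], M' =1 M} ->
  links M t a -> links M' t a.
Proof.
elim: t a => [x|l IHl r IHr] a /= E; first by rewrite E // inE; lia.
case=> Ma Ll Lr; split; first by rewrite E // inE; lia.
  by apply: IHl Ll => z; rewrite inE => zin; apply: E; rewrite inE; lia.
by apply: IHr Lr => z; rewrite inE => zin; apply: E; rewrite inE; lia.
Qed.

Lemma leaf_address_bounds t a x : a <= leaf_address t a x < a + esize t.
Proof.
elim: t a => [y|l IHl r IHr] a /=; first by lia.
by case: ifP => _; [have := IHl a.+1 | have := IHr (a.+1 + esize l)]; lia.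
Qed.

(* The cell of a pending node, whose right child is yet to be read, links to the
   next pending node; register 8 is the top of this stack. *)
Definition parse_loop : prog :=
  While (TLt 7 3) (
    Read 13 7 ;;
    If (TEq 13 16)
      (Add 7 7 1 ;; Read 10 7 ;; Add 10 4 10 ;; Defs.Sub 14 7 1 ;; Write 10 14 ;;
       Add 7 7 1 ;; Read 13 8 ;; Write 8 7 ;; Add 8 13 16)
      (Write 7 8 ;; Add 8 7 16 ;; Add 7 7 1)).

(** One loop reads the whole tree, so a subtree is treated in continuation form, with budget [T] for
    the rest of the loop. Each leaf pops the stack once and links the popped node to the next
    address. The last leaf of a left subtree thus pops the parent; that of a right subtree pops [p],
    the node that was on top when the parent was met. *)
Lemma parse_loop_runs lab ans m V P K X i r11 r12 r15 Q t :
  V <= P -> uniq (map lab (front t)) ->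
  forall a p r10 r13 r14 M T,
  stores M a (enc lab t) -> p < a -> a + esize t <= V ->
  (forall M' r10' r13' r14',
    links M' t a ->
    {in front t, forall x, M' (P + lab x) = leaf_address t a x} ->
    M' p = a + esize t ->
    (forall z, ~~ (a <= z < a + esize t) -> z != p ->
       {in front t, forall x, z != P + lab x} -> M' z = M z) ->
    runs parse_loop [:: ans; 1; m; V; P; K; X; a + esize t; M p; i; r10'; r11;
      r12; r13'; r14'; r15; 0] M' T Q) ->
  runs parse_loop [:: ans; 1; m; V; P; K; X; a; p; i; r10; r11; r12; r13; r14;
    r15; 0] M (T + 12 * esize t) Q.
Proof.
move=> VP; elim: t => [x|l IHl r IHr] ul a p r10 r13 r14 M T st pa aV HQ.
  have [M0 /stores_cons[M1 _]] := (stores_cons _ _ _ _).1 st.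
  apply: (@runs_le (12 + T).+1); last by rewrite /=; lia.
  apply: runs_while_true => /=; first by move: aV => /=; lia.
  step; apply: runs_if => //=; last by rewrite M0.
  move=> _; do 9 step.
  rewrite addn0 (addn1 a) M1 subn1 /=.
  have -> : a.+1 + 1 = a + esize (BLeaf x) by rewrite /=; lia.
  have np : p != P + lab x by rewrite /= in aV; lia.
  rewrite updNE //; apply: HQ => /=.
  - by rewrite !updNE ?M0 //; rewrite /= in aV; lia.
  - by move=> y; rewrite inE => /eqP ->; rewrite updNE ?updE // eq_sym.
  - by rewrite updE.
  - by move=> z _ zp /(_ x); rewrite inE eqxx => /(_ isT) zx; rewrite !updNE.
have [M0 st1] := (stores_cons _ _ _ _).1 st.
have [stl str] := (stores_cat _ _ _ _).1 st1; rewrite size_encE in str.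
have [l0 r0] := (esize_gt0 l, esize_gt0 r).
have aV' := aV; rewrite /= in aV'.
move: ul; rewrite /= map_cat cat_uniq => /and3P[ul /hasPn dlr ur].
apply: (@runs_le (5 + (T + 12 * esize r + 12 * esize l)).+1); last by rewrite /=; lia.
apply: runs_while_true => /=; first by lia.
step; apply: runs_if => //=; first by rewrite M0.
move=> _; do 3 step; rewrite addn0 (addn1 a).
apply: IHl => //; [|lia|].
  apply: stores_eq stl => z; rewrite inE size_encE => zin.
  by rewrite updNE //; lia.
move=> M2 b2 t2 u2 Ll locl M2a eM2; rewrite updE.
apply: IHr => //; [|lia|lia|].
  apply: stores_eq str => z; rewrite inE size_encE => zin.
  by rewrite eM2 ?updNE //; [lia|lia|lia| move=> x _; lia].
move=> M3 b3 t3 u3 Lr locr M3p eM3.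
have -> : M2 p = M p.
  by rewrite eM2 ?updNE //; [lia|lia|lia| move=> x _; lia].
rewrite (_ : a.+1 + esize l + esize r = a + esize (BNode l r)) in M3p *;
  last by rewrite /=; lia.
apply: HQ => //.
- split=> //; first by rewrite eM3 //; [lia|lia| move=> x _; lia].
  apply: links_eq Ll => z; rewrite inE => zin.
  by rewrite eM3 //; [lia|lia| move=> x _; lia].
- move=> x; rewrite /= mem_cat; case: ifP => /= [xl _|_ xr]; last exact: locr.
  rewrite eM3 ?locl //; [lia|lia|].
  (* Distinct labels keep the right subtree from overwriting the leaf addresses of the left one. *)
  move=> y yr; rewrite eqn_add2l; apply/eqP => e.
  by have /negP[] := dlr _ (map_f lab yr); rewrite -e map_f.
- move=> z /= zout zp zx; rewrite eM3 ?eM2 ?updNE //; try lia.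
  + by move=> x xl; apply: zx; rewrite mem_cat xl.
  + by move=> x xr; apply: zx; rewrite mem_cat xr orbT.
Qed.

(** * Counting inversions by walks down the tree *)

Definition below (i : nat) (s : seq nat) : nat := count (fun y => y < i) s.

(** The part of [crossings s1 s2] known once the candidates below [i] are handled: an inversion is
    charged to its larger member, when the smaller one has already been counted. *)
Definition crossed (i : nat) (s1 s2 : seq nat) : nat :=
  \sum_(x <- s1 | x < i) below x s2.

Lemma belowS i s : uniq s -> below i.+1 s = below i s + (i \in s).
Proof.
rewrite /below; elim: s => //= x s IH /andP[xs /IH ->]; rewrite inE ltnS.
case: ltngtP => [xi|xi|xi] //=; try lia.
by move: xs; rewrite xi; case: (i \in s) => //=; lia.
Qed.

Lemma crossedS i s1 s2 : uniq s1 ->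
  crossed i.+1 s1 s2 = crossed i s1 s2 + (i \in s1) * below i s2.
Proof.
rewrite /crossed; elim: s1 => [|x s IH] /=; first by rewrite !big_nil.
case/andP=> xs /IH e; rewrite !big_cons e inE ltnS.
case: ltngtP => [xi|xi|xi] //=; first by rewrite addnA.
by move: xs; rewrite xi => /negPf ->; lia.
Qed.

Lemma crossed_all m s1 s2 : all (gtn m) s1 -> crossed m s1 s2 = crossings s1 s2.
Proof.
move=> /allP a1; rewrite /crossed /crossings big_seq_cond [RHS]big_seq.
by apply: eq_bigl => x; case xs: (x \in s1) => //=; exact: a1.
Qed.

(* For a child at address a, the cell K + a counts the leaves of its subtree
   that are below i, and the cell X + a counts the inversions between these and
   the leaves of its sibling. *)
Fixpoint tally (K X i : nat) (M : nat -> nat) (t : btree nat) (a : nat) : Prop :=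
  match t with
  | BLeaf _ => True
  | BNode l r =>
    let ra := a.+1 + esize l in
    [/\ M (K + a.+1) = below i (front l) /\ M (K + ra) = below i (front r),
        M (X + a.+1) = crossed i (front l) (front r) /\
        M (X + ra) = crossed i (front r) (front l),
        tally K X i M l a.+1 & tally K X i M r ra]
  end.

Lemma tally_eq K X i M M' t a :
  (forall z, a < z < a + esize t -> M' (K + z) = M (K + z)) ->
  (forall z, a < z < a + esize t -> M' (X + z) = M (X + z)) ->
  tally K X i M t a -> tally K X i M' t a.
Proof.
elim: t a => //= l IHl r IHr a EK EX [[k1 k2] [x1 x2] tl tr].
have [l0 r0] := (esize_gt0 l, esize_gt0 r).
split; first by rewrite !EK //; lia.
- by rewrite !EX //; lia.
- by apply: IHl tl => z zin; [apply: EK | apply: EX]; lia.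
- by apply: IHr tr => z zin; [apply: EK | apply: EX]; lia.
Qed.

Lemma tally_skip K X i M t a : uniq (front t) -> i \notin front t ->
  tally K X i M t a -> tally K X i.+1 M t a.
Proof.
elim: t a => //= l IHl r IHr a.
rewrite cat_uniq mem_cat negb_or => /and3P[ul _ ur] /andP[il ir].
case=> [[k1 k2] [x1 x2] tl tr].
rewrite !belowS // !crossedS // (negPf il) (negPf ir) !mul0n !addn0.
by split=> //; [exact: IHl | exact: IHr].
Qed.

Lemma tally0 K X M t a : (forall z, K <= z -> M z = 0) -> K <= X ->
  tally K X 0 M t a.
Proof.
move=> M0 KX; elim: t a => //= l IHl r IHr a.
have b0 s : below 0 s = 0 by rewrite /below (eq_count (a2 := pred0)) ?count_pred0.
have c0 s1 s2 : crossed 0 s1 s2 = 0 by rewrite /crossed big_pred0.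
by rewrite !b0 !c0 !M0 //; lia.
Qed.

(** Preorder addresses steer the walk: the leaf is in the left subtree when its address is below
    that of the right child. Register 15 is the child entered, register 12 its sibling. *)
Definition descend_loop : prog :=
  While (TLt 7 10) (
    Add 15 7 1 ;; Read 11 7 ;;
    If (TLt 10 11) (Add 12 11 16) (Add 12 15 16 ;; Add 15 11 16) ;;
    Add 13 5 12 ;; Read 13 13 ;; Add 14 6 15 ;; Read 11 14 ;; Add 11 11 13 ;;
    Write 14 11 ;;
    Add 13 5 15 ;; Read 14 13 ;; Add 14 14 1 ;; Write 13 14 ;; Add 7 15 16).

(** The memory effect of one iteration, where [n] is the child entered and [o] its sibling. *)
Definition visit (K X n o : nat) (M : nat -> nat) : nat -> nat :=
  let M1 := upd M (X + n) (M (X + n) + M (K + o)) in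
  upd M1 (K + n) (M1 (K + n) + 1).

Lemma visit_other K X n o M z : z != K + n -> z != X + n ->
  visit K X n o M z = M z.
Proof. by move=> zK zX; rewrite /visit !updNE. Qed.

Lemma visitK K X n o M : K + n != X + n ->
  visit K X n o M (K + n) = M (K + n) + 1.
Proof. by move=> KX; rewrite /visit updE updNE. Qed.

Lemma visitX K X n o M : K + n != X + n ->
  visit K X n o M (X + n) = M (X + n) + M (K + o).
Proof. by move=> KX; rewrite /visit updNE 1?eq_sym // updE. Qed.

(** The sibling's subtree does not contain [i], so its tallies stay valid for [i.+1] untouched; the
    subtree entered is handled by induction. The bounds on [V], [K] and [X] keep the links and the
    two counter arrays disjoint. *)
Lemma descend_loop_runs ans m V P K X p i t a r11 r12 r13 r14 r15 M Q :
  links M t a -> tally K X i M t a -> i \in front t -> uniq (front t) ->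
  a + esize t <= V -> V <= K -> K + V <= X ->
  (forall M' a' r11' r12' r13' r14' r15',
    tally K X i.+1 M' t a ->
    (forall z, ~~ (K + a < z < K + a + esize t) ->
       ~~ (X + a < z < X + a + esize t) -> M' z = M z) ->
    Q [:: ans; 1; m; V; P; K; X; a'; p; i; leaf_address t a i; r11'; r12'; r13';
          r14'; r15'; 0] M') ->
  runs descend_loop [:: ans; 1; m; V; P; K; X; a; p; i; leaf_address t a i; r11;
    r12; r13; r14; r15; 0] M (17 * height t + 1) Q.
Proof.
elim: t a r11 r12 r13 r14 r15 M => [x|l IHl r IHr] a r11 r12 r13 r14 r15 M.
  move=> _ _ _ _ _ _ _ HQ; apply: runs_while_false => //=; first by rewrite ltnn.
  exact: HQ.
case=> Ma Ll Lr [[k1 k2] [x1 x2] tl tr] it ut aV VK KX HQ.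
have [l0 r0] := (esize_gt0 l, esize_gt0 r).
have := ut; rewrite /= cat_uniq => /and3P[ul /hasPn dlr ur].
have aV' := aV; rewrite /= in aV'.
have := leaf_address_bounds (BNode l r) a i.
rewrite [leaf_address _ _ _]/=; set b := (if _ then _ else _) => /andP[ab bV].
have ab' : a < b.
  have := leaf_address_bounds l a.+1 i.
  have := leaf_address_bounds r (a.+1 + esize l) i.
  by rewrite /b; case: ifP; lia.
have [hl hr] : height l <= maxn (height l) (height r) /\
    height r <= maxn (height l) (height r).
  by rewrite leq_maxl leq_maxr.
move: (maxn _ _) hl hr => h hl hr.
apply: (@runs_le (16 + (17 * h + 1)).+1); last lia.
apply: runs_while_true => //=.
do 2 step; rewrite Ma (addn1 a).
have tr' : i \notin front r -> tally K X i.+1 M r (a.+1 + esize l).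
  by move=> ir; exact: tally_skip.
have tl' : i \notin front l -> tally K X i.+1 M l a.+1.
  by move=> il; exact: tally_skip.
move: it ut HQ ab bV; rewrite /b /= mem_cat => it ut HQ ab bV; clear b ab'.
have [il|il] := boolP (i \in front l); rewrite ?il ?(negPf il) /= in it HQ ab bV *.
  have ir : i \notin front r by apply/negP => /dlr; rewrite /= il.
  have := leaf_address_bounds l a.+1 i => bl.
  apply: runs_if_seq => //= [_|]; last by lia.
  do 12 step; rewrite !addn0 -/(visit K X a.+1 (a.+1 + esize l) M).
  have nKX : K + a.+1 != X + a.+1 by lia.
  have ve z : z != K + a.+1 -> z != X + a.+1 ->
    visit K X a.+1 (a.+1 + esize l) M z = M z by exact: visit_other.
  apply: (@runs_le (17 * height l + 1)); last lia.
  apply: IHl => //; [| |lia|].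
  - by apply: links_eq Ll => z; rewrite inE => zin; rewrite ve; lia.
  - by apply: tally_eq tl => z zin; rewrite ve; lia.
  move=> M' a' q1 q2 q3 q4 q5 tM' eM'; apply: HQ => [|z z1 z2]; last first.
    by rewrite eM' ?ve; lia.
  split=> //.
  - by rewrite !belowS // il (negPf ir) addn0 -k1 -k2 !eM' ?visitK ?ve; lia.
  - rewrite !crossedS // il (negPf ir) mul1n addn0 -x1 -x2 -k2 !eM' ?visitX ?ve; lia.
  - by apply: tally_eq (tr' ir) => z zin; rewrite eM' ?ve; lia.
have {tl'}tl' := tl' il.
have bl := leaf_address_bounds r (a.+1 + esize l) i.
apply: runs_if_seq => //= [|_]; first by lia.
do 13 step; rewrite !addn0 -/(visit K X (a.+1 + esize l) a.+1 M).
have nKX : K + (a.+1 + esize l) != X + (a.+1 + esize l) by lia.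
have ve z : z != K + (a.+1 + esize l) -> z != X + (a.+1 + esize l) ->
  visit K X (a.+1 + esize l) a.+1 M z = M z by exact: visit_other.
apply: (@runs_le (17 * height r + 1)); last lia.
apply: IHr => //; [| |lia|].
- by apply: links_eq Lr => z; rewrite inE => zin; rewrite ve; lia.
- by apply: tally_eq tr => z zin; rewrite ve; lia.
move=> M' a' q1 q2 q3 q4 q5 tM' eM'; apply: HQ => [|z z1 z2]; last first.
  by rewrite eM' ?ve; lia.
split=> //.
- by rewrite !belowS // it (negPf il) addn0 -k1 -k2 !eM' ?visitK ?ve; lia.
- rewrite !crossedS // it (negPf il) mul1n addn0 -x1 -x2 -k1 !eM' ?visitX ?ve; lia.
- by apply: tally_eq tl' => z zin; rewrite eM' ?ve; lia.
Qed.

Definition process_loop : prog :=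
  While (TLt 9 2) (
    Add 13 3 9 ;; Read 13 13 ;; Add 13 4 13 ;; Read 10 13 ;; Const 7 1 ;;
    descend_loop ;; Add 9 9 1).

Lemma process_loop_runs lab ans m V P K X t p i r7 r10 r11 r12 r13 r14 r15 M Q :
  perm_eq (front t) (iota 0 m) -> 1 + esize t <= V -> V <= K -> K + V <= X ->
  V + m <= K -> (forall j, j < m -> P + lab j < K) -> i <= m ->
  links M t 1 -> tally K X i M t 1 ->
  (forall j, j < m -> M (V + j) = lab j) ->
  (forall j, j < m -> M (P + lab j) = leaf_address t 1 j) ->
  (forall M' r7' r10' r11' r12' r13' r14' r15',
    links M' t 1 -> tally K X m M' t 1 ->
    Q [:: ans; 1; m; V; P; K; X; r7'; p; m; r10'; r11'; r12'; r13'; r14'; r15'; 0]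
      M') ->
  runs process_loop [:: ans; 1; m; V; P; K; X; r7; p; i; r10; r11; r12; r13; r14;
    r15; 0] M ((17 * height t + 9) * (m - i) + 1) Q.
Proof.
move=> pt tV VK KX VmK PK.
move: {2}(m - i) (erefl (m - i)) => d.
elim: d i r7 r10 r11 r12 r13 r14 r15 M => [|d IH] i r7 r10 r11 r12 r13 r14 r15 M dE im.
  have e : i = m by lia.
  subst i => L tl _ _ HQ.
  apply: runs_while_false; [by rewrite /= ltnn | by rewrite addn1 | exact: HQ].
move=> L tl Mv Mloc HQ; have {}im : i < m by lia.
have it : i \in front t by rewrite (perm_mem pt) mem_iota.
have ut : uniq (front t) by rewrite (perm_uniq pt) iota_uniq.
apply: (@runs_le (5 + (17 * height t + 1 + 1) +
                  ((17 * height t + 9) * (m - i.+1) + 1)).+1); last first.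
  by rewrite dE (_ : m - i.+1 = d); lia.
apply: runs_while_true => //=.
do 5 step; rewrite add0n Mv // Mloc //.
apply: runs_seq; apply: (descend_loop_runs L tl) => // M' a' q1 q2 q3 q4 q5 tM' eM'.
step; rewrite addn1.
have eK z : z < K -> M' z = M z by move=> zK; rewrite eM' //; lia.
apply: IH => //; first lia.
- by apply: links_eq L => z; rewrite inE => zin; apply: eK; lia.
- by move=> j jm; rewrite eK ?Mv //; lia.
- by move=> j jm; rewrite eK ?Mloc // PK.
Qed.

(** A linear pass over the preorder cells suffices: a zero cell starts a leaf and is skipped with
    its label, any other cell met is the right link of an internal node whose left child is in the
    next cell. *)
Definition scan_loop : prog :=
  While (TLt 7 3) (
    Read 11 7 ;;
    If (TEq 11 16) (Add 7 7 1 ;; Add 7 7 1)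
      (Add 7 7 1 ;; Add 13 6 7 ;; Read 13 13 ;; Add 14 6 11 ;; Read 14 14 ;;
       If (TLt 13 14) (Add 0 0 13) (Add 0 0 14))).

Lemma scan_loop_runs m V P K X p i M Q t :
  forall a ans r10 r11 r12 r13 r14 r15 T,
  links M t a -> tally K X m M t a -> all (gtn m) (front t) -> a + esize t <= V ->
  (forall r11' r13' r14',
    runs scan_loop [:: ans + dist t; 1; m; V; P; K; X; a + esize t; p; i; r10;
      r11'; r12; r13'; r14'; r15; 0] M T Q) ->
  runs scan_loop [:: ans; 1; m; V; P; K; X; a; p; i; r10; r11; r12; r13; r14;
    r15; 0] M (T + 10 * esize t) Q.
Proof.
elim: t => [x|l IHl r IHr] a ans r10 r11 r12 r13 r14 r15 T.
  move=> M0 _ _ aV HQ.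
  apply: (@runs_le (4 + T).+1); last by rewrite /=; lia.
  rewrite /= in M0 aV HQ.
  apply: runs_while_true => /=; first by lia.
  step; apply: runs_if => //=; last by rewrite M0.
  move=> _; do 2 step.
  by have := HQ (M a) r13 r14; rewrite addn0 !addn1 addn2.
case=> Ma Ll Lr [[k1 k2] [x1 x2] tl tr] /=; rewrite all_cat => /andP[al ar] aV HQ.
have [l0 r0] := (esize_gt0 l, esize_gt0 r).
apply: (@runs_le (9 + (T + 10 * esize r + 10 * esize l)).+1); last by lia.
apply: runs_while_true => /=; first by lia.
step; apply: runs_if => //=; first by rewrite Ma.
move=> _; do 5 step; rewrite Ma (addn1 a) x1 x2 !crossed_all //.
have key ans' q1 q2 q3 :
  ans' = ans + minn (crossings (front l) (front r)) (crossings (front r) (front l)) ->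
  runs scan_loop [:: ans'; 1; m; V; P; K; X; a.+1; p; i; r10; q1; r12; q2; q3; r15; 0]
    M (T + 10 * esize r + 10 * esize l) Q.
  move=> e; apply: IHl => // [|q4 q5 q6]; first lia.
  apply: IHr => // [|q7 q8 q9]; first lia.
  have := HQ q7 q8 q9.
  congr (runs _ [:: _, _, _, _, _, _, _, _ & _] _ _ _); last by lia.
  by rewrite e; lia.
by apply: runs_if => //= [h|/negPf h]; step; apply: key; rewrite /minn h.
Qed.

(** Register 6 is the base 8 * m of the inversion counters: the counts based at 5 * m are indexed by
    tree addresses, which are below 3 * m. *)
Definition bal_prog : prog :=
  setup ;; Add 6 5 3 ;; Const 7 1 ;; parse_loop ;; process_loop ;;
  Const 7 1 ;; scan_loop.

(** * Logarithmic height and total running time *)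

Definition bbalanced (t : btree nat) : bool :=
  all2rel (fun d e => d <= e.+1) (leaf_depths (otree_of t)).

Lemma leaf_depths_bmap A B (f : A -> B) t :
  leaf_depths (otree_of (bmap f t)) = leaf_depths (otree_of t).
Proof. by elim: t => //= l -> r ->. Qed.

Lemma height_leaf_depths A (t : btree A) : height t \in leaf_depths (otree_of t).
Proof.
elim: t => //= l IHl r IHr; rewrite cats0 mem_map; last exact: succn_inj.
by rewrite mem_cat; case: leqP => _; rewrite ?IHl ?IHr ?orbT.
Qed.

Lemma expn_le_leaves A (t : btree A) n :
  all (leq n) (leaf_depths (otree_of t)) -> 2 ^ n <= size (front t).
Proof.
elim: t n => [x|l IHl r IHr] [|n] //=.
  by move=> _; rewrite size_cat (leq_trans (IHl 0 _)) ?leq_addr //; apply/allP.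
rewrite cats0 all_map all_cat size_cat expnS mul2n -addnn => /andP[al ar].
by rewrite leq_add // ?IHl ?IHr.
Qed.

(** The height h is itself a leaf depth, so by balance every leaf has depth at least h - 1, which
    forces 2 ^ (h - 1) leaves. *)
Lemma bbalanced_height t : bbalanced t -> height t <= trunc_log 2 (size (front t)) + 1.
Proof.
move=> /allrelP b; case eh: (height t) => [|h] //.
rewrite addn1 ltnS; apply: trunc_log_max => //; apply: expn_le_leaves.
by apply/allP => d din; have := b _ _ (height_leaf_depths t) din; rewrite eh ltnS.
Qed.

(** The budgets of setup, parser, walks and final scan, nested as [runs_seq] produces them; [e] is
    the number of cells of the tree. *)
Lemma bal_time m h T e : 0 < m -> e = 3 * m - 1 -> h <= T + 1 ->
  8 + ((1 + 12 * e) + (((17 * h + 9) * (m - 0) + 1) + (1 + (1 + 10 * e)))) <=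
  100 * (m * (T + 1)).
Proof.
move=> m0 -> hT; have : h * m <= (T + 1) * m by rewrite leq_mul2r hT orbT.
have : T + 1 <= m * (T + 1) by rewrite leq_pmull.
by rewrite mulnDl; nia.
Qed.

Lemma bal_prog_runs m lab t : 0 < m -> bbalanced t ->
  perm_eq (front t) (iota 0 m) ->
  {in gtn m &, injective lab} -> (forall i, i < m -> lab i < m) ->
  exists k s, [/\
    exec bal_prog (init_state (m :: enc lab t ++ map lab (iota 0 m))) k s,
    k <= 100 * (m * (trunc_log 2 m + 1)) & reg s 0 = dist t].
Proof.
move=> m0 bt pt inj lt_m.
have sm : size (front t) = m by rewrite (perm_size pt) size_iota.
have [se _] := size_enc lab t; rewrite sm size_encE in se.
have hT := bbalanced_height bt; rewrite sm in hT.
apply: (runs_exec (regs := 17) (P := fun d => d = dist t)).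
have [M0 st sv z0] := initial_memory lab sm.
move: (nth 0 _) M0 st sv z0 => M M0 st sv z0.
apply: (runs_le _ (bal_time m0 se hT)).
rewrite /bal_prog /setup.
do 8 step.
rewrite M0.
have [-> -> ->] : [/\ m + m + m = 3 * m, 3 * m + m = 4 * m & 4 * m + m = 5 * m].
  by split; lia.
rewrite add0n (_ : 5 * m + 3 * m = 8 * m); last lia.
have eV : 1 + esize t = 3 * m by lia.
(* Register 8 is still 0, so cell 0 acts as the bottom of the stack; overwriting it is harmless
   because m is already in register 2. *)
apply: runs_seq; apply: (@parse_loop_runs lab) => //.
- lia.
- rewrite map_inj_in_uniq ?(perm_uniq pt) ?iota_uniq // => x y.
  by rewrite !(perm_mem pt) !mem_iota; apply: inj.
- by rewrite eV.
move=> M' q1 q2 q3 L loc _ eM.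
apply: runs_while_false => //=; first by rewrite eV ltnn.
have fr x : x \in front t -> x < m by rewrite (perm_mem pt) mem_iota.
apply: runs_seq; apply: (@process_loop_runs lab) => //; try lia.
- by move=> j jm; have := lt_m j jm; lia.
- apply: tally0; last lia.
  move=> z zK; rewrite eM ?z0 //; try lia.
  by move=> x /fr /lt_m; lia.
- move=> j jm; rewrite eM; [|lia|lia|by move=> x /fr /lt_m; lia].
  have := congr1 (fun s => nth 0 s j) sv.
  by rewrite size_map size_iota !(nth_map 0) ?size_iota // !nth_iota.
- by move=> j jm; rewrite loc // (perm_mem pt) mem_iota.
move=> M1 r7 r10 r11 r12 r13 r14 r15 L1 t1.
step; apply: scan_loop_runs => //.
- by apply/allP => x /fr.
- by rewrite eV.
by move=> q4 q5 q6; apply: runs_while_false => //=; rewrite eV ltnn.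
Qed.

Lemma bal_computable :
  swap_computable_in (fun C : finType => @balanced C) (fun m => m * trunc_log 2 m).
Proof.
apply: (swap_computableI (bclass := bbalanced)
         (time := fun m => 100 * (m * (trunc_log 2 m + 1)))).
- by move=> C T /andP[+ _]; apply: all_nodes_binary.
- by move=> C b f /andP[_]; rewrite /bbalanced leaf_depths_bmap.
- exact: bigO_log.
- exact: bal_prog_runs.
Qed.

Theorem theorem4p8 :
  swap_computable_in (fun C : finType => @caterpillar C)
    (fun m => m * trunc_log 2 m) /\
  swap_computable_in (fun C : finType => @balanced C)
    (fun m => m * trunc_log 2 m).
Proof. by split; [exact: cat_computable | exact: bal_computable]. Qed.
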